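(* Let $G$ be a tree with vertex set $\{v_1,\dots,v_n\}$ and diameter at least three. Then there are no graphs $H_1,\dots,H_n$ such that the blow-up $G[H_1,\dots,H_n]$ is betweenness-uniform.
   Context: All graphs are finite and simple; each $H_i$ has at least one vertex. For a graph $G=(V,E)$ and $x\in V$, the betweenness centrality of $x$ is $B(x)=\sum_{\{u,v\}\subseteq V\setminus\{x\},\,u\neq v}\frac{\sigma_{u,v}(x)}{\sigma_{u,v}}$, where $\sigma_{u,v}$ is the number of shortest $uv$-paths and $\sigma_{u,v}(x)$ is the number of those passing through $x$. A graph is betweenness-uniform if $B(x)$ takes the same value for all its vertices. For a graph $G$ on vertex set $\{v_1,\dots,v_n\}$ and graphs $H_1,\dots,H_n$ (with pairwise disjoint vertex sets), the blow-up $G[H_1,\dots,H_n]$ is the graph with vertex set $\bigcup_{i=1}^n V(H_i)$ and edge set $\bigcup_{i=1}^n E(H_i)\cup\{uv : u\in V(H_i), v\in V(H_j), v_iv_j\in E(G)\}$. The diameter of a graph is the maximum distance between two of its vertices. *)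

(* Defs.v *)
From HB Require Import structures.
From mathcomp Require Import all_boot all_order all_algebra.

Set Implicit Arguments.
Unset Strict Implicit.
Unset Printing Implicit Defensive.

Import GRing.Theory Num.Theory.

Record sgraph := SGraph {
  vertex :> finType;
  adj : rel vertex;
  adj_sym : symmetric adj;
  adj_irrefl : irreflexive adj
}.
Arguments adj {s}.

(* The path visits u :: p; its length (number of edges) is size p. *)
Definition upath (G : sgraph) (u v : G) (p : seq G) : bool :=
  [&& path adj u p, last u p == v & uniq (u :: p)].

(* Paths have length less than #|G|, so this is the least length of a
   uv-path; it takes the value #|G| when there is no uv-path. *)
Definition dist (G : sgraph) (u v : G) : nat :=
  find (fun k => [exists p : k.-tuple G, upath u v p]) (iota 0 #|G|).

Definition diameter (G : sgraph) : nat :=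
  \max_(u : G) \max_(v : G) dist u v.

(* Since dist u v is the least length of a uv-path, these are exactly the
   shortest uv-paths. *)
Definition geodesics (G : sgraph) (u v : G) : {set (dist u v).-tuple G} :=
  [set p : (dist u v).-tuple G | upath u v p].

Definition sigma (G : sgraph) (u v : G) : nat := #|geodesics u v|.

Definition sigma_through (G : sgraph) (u v x : G) : nat :=
  #|[set p in geodesics u v | x \in u :: p]|.

(* The condition on enum_rank picks each unordered pair {u, v} with u != v
   exactly once; the summand is symmetric in u and v. *)
Definition betweenness (G : sgraph) (x : G) : rat :=
  (\sum_(u : G | u != x)
     \sum_(v : G | (v != x) && (enum_rank u < enum_rank v)%N)
        (sigma_through u v x)%:R / (sigma u v)%:R)%R.

Definition betweenness_uniform (G : sgraph) : Prop :=
  forall x y : G, betweenness x = betweenness y.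

Definition connected_graph (G : sgraph) : Prop :=
  forall u v : G, connect adj u v.

(* ucycle alone also accepts sequences of length at most 2, which are not
   graph cycles. *)
Definition acyclic (G : sgraph) : Prop :=
  forall c : seq G, ucycle adj c -> size c <= 2.

Definition is_tree (G : sgraph) : Prop := connected_graph G /\ acyclic G.

Section BlowUp.

Variables (G : sgraph) (H : G -> sgraph).

(* The tagged union makes the vertex sets of the H i disjoint. *)
Definition blowup_adj : rel {i : G & H i} := fun u v =>
  if tag u == tag v then adj (tagged u) (tagged_as u v)
  else adj (tag u) (tag v).

Lemma blowup_adj_sym : symmetric blowup_adj.
Proof.
case=> i a [j b]; rewrite /blowup_adj /= (eq_sym j i).
case: (eqVneq i j) => [eq_ij | _]; last exact: adj_sym.
by case: j / eq_ij b => b; rewrite !tagged_asE; apply: adj_sym.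
Qed.

Lemma blowup_adj_irrefl : irreflexive blowup_adj.
Proof.
by case=> i a; rewrite /blowup_adj /= eqxx tagged_asE; apply: adj_irrefl.
Qed.

Definition blowup : sgraph := SGraph blowup_adj_sym blowup_adj_irrefl.

End BlowUp.

(* Main.v *)
Require Import Defs.
From mathcomp Require Import all_boot all_order all_algebra.
From mathcomp Require Import zify ring lra.

(** Take a longest path of [G] and let [l], [p], [q] be its first three
vertices, so that [l] is a leaf with neighbour [p]; write [a], [b], [c] for the
sizes of [H l], [H p], [H q], and [Q] for the betweenness that each vertex of
[H l] or [H q] receives from the pairs of nonadjacent vertices of [H p].

Averaging over [H l], where only pairs inside [H l] or inside [H p] matter,
betweenness is at most [Q + a^2 / (2 (a + b))].  Averaging over [H q], it is at
least [Q + (a + b) z / c], where [z] is the total size of blocks separated from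
[p] by [q].  Averaging over [H p], it is at least [a c / b], while
[Q <= b^2 / (2 (a + c))].  Uniformity therefore yields
    [2 (a + b)^2 z <= c a^2]     and
    [a c <= b (b^2 / (2 (a + c)) + a^2 / (2 (a + b)))],
and the two together give [2 z < a + b].

If the path has at least five vertices, [z] can be taken to be the total size
[a' + b'] of the last two blocks, and the symmetric inequality at the other end
gives a contradiction.  If it has four, the first inequality at each end,
with [z = a'] and [z = a], is already contradictory. *)

Set Implicit Arguments.
Unset Strict Implicit.
Unset Printing Implicit Defensive.

Import Order.TTheory GRing.Theory Num.Theory.

(** * Distances, shortest paths, and pairs at distance two *)

Section Distance.

Variable G : sgraph.
Implicit Types (u v x : G) (p : seq G).

(** The walk may repeat vertices: cutting out its loops leaves a path that is no longer, and the
    search in [dist] stops at its length or before. *)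
Lemma dist_le_path u p : path adj u p -> dist u (last u p) <= size p.
Proof.
case/shortenP=> q qP qU sub_qp.
have /leq_trans -> // : dist u (last u q) <= size q; last first.
  by apply: uniq_leq_size sub_qp; case/andP: qU.
(* [dist] searches only lengths below [#|G|]; distinct vertices keep [q] in that range. *)
have ltqG : size q < #|G|.
  by move/card_uniqP: qU => /= <-; apply: max_card.
rewrite leqNgt; apply/negP => /[dup] lt_q /(before_find 0).
rewrite nth_iota // add0n => /existsP[]; exists (in_tuple q) => /=.
by rewrite /upath /= qP eqxx.
Qed.

Lemma dist_geodesic u v : connect adj u v ->
  exists p : (dist u v).-tuple G, upath u v p.
Proof.
case/connectP=> p0 /shortenP[p pP pU _] ->.
have ltpG : size p < #|G|.
  by move/card_uniqP: pU => /= <-; apply: max_card.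
set P := fun k => [exists q : k.-tuple G, upath u (last u p) q].
have hasP : has P (iota 0 #|G|).
  apply/hasP; exists (size p); first by rewrite mem_iota.
  by apply/existsP; exists (in_tuple p); rewrite /upath pP eqxx.
have := nth_find 0 hasP; rewrite nth_iota; first exact: existsP.
by rewrite has_find size_iota in hasP.
Qed.

Lemma sigma_gt0 u v : connect adj u v -> 0 < sigma u v.
Proof.
by case/dist_geodesic=> p pP; apply/card_gt0P; exists p; rewrite inE.
Qed.

Lemma dist_walk u v : connect adj u v ->
  exists p, [/\ path adj u p, last u p = v & size p = dist u v].
Proof.
case/dist_geodesic=> p /and3P[pP /eqP lp _].
by exists p; rewrite size_tuple.
Qed.

Lemma dist_sym_le u v : connect adj u v -> dist v u <= dist u v.
Proof.
case/dist_walk=> p [pP <- <-].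
rewrite -(size_belast u p) -size_rev.
have -> : dist (last u p) u
          = dist (last u p) (last (last u p) (rev (belast u p))).
  by case: p {pP} => //= y p; rewrite rev_cons last_rcons.
apply: dist_le_path; rewrite rev_path (eq_path (e' := adj)) // => x y.
exact: adj_sym.
Qed.

Lemma dist_triangle u x v : connect adj u x -> connect adj x v ->
  dist u v <= dist u x + dist x v.
Proof.
move=> /dist_walk[p [pP lp <-]] /dist_walk[q [qP lq <-]].
rewrite -size_cat -lq -lp -last_cat; apply: dist_le_path.
by rewrite cat_path pP lp.
Qed.

Lemma dist_adj_le u v : adj u v -> dist u v <= 1.
Proof. by move=> uv; apply: (@dist_le_path u [:: v]); rewrite /= uv. Qed.

Lemma dist_gt0 u v : connect adj u v -> u != v -> 0 < dist u v.
Proof. by case/dist_walk=> -[|y p] [_ /= <- <-] //; rewrite eqxx. Qed.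

Lemma sigma_through_dist u v x : 0 < sigma_through u v x ->
  dist u x + dist x v <= dist u v.
Proof.
case/card_gt0P=> p; rewrite !inE => /andP[/and3P[pP /eqP lp _] xp].
rewrite -[leqRHS](size_tuple p); case/splitPl: xp pP lp => p1 p2 lp1.
rewrite cat_path last_cat lp1 size_cat => /andP[p1P p2P] lp2.
by apply: leq_add; [rewrite -lp1 | rewrite -lp2]; apply: dist_le_path.
Qed.

Definition common u v : {set G} := [set w | adj u w && adj w v].

Lemma dist2 u v x : connect adj u v -> u != v -> ~~ adj u v ->
  x \in common u v -> dist u v = 2.
Proof.
move=> cuv neq_uv nadj; rewrite inE => /andP[ux xv].
apply/eqP; rewrite eqn_leq (@dist_le_path u [:: x; v]) /= ?ux ?xv //.
case/dist_walk: cuv => -[|y [|z p]] [//= pP lp <-] //.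
  by rewrite lp eqxx in neq_uv.
by rewrite -lp /= andbT in nadj pP *; rewrite pP in nadj.
Qed.

Lemma sigma_through2 u v x : dist u v = 2 -> u != v -> x != u -> x != v ->
  sigma_through u v x = (x \in common u v).
Proof.
move=> d2 neq_uv neq_xu neq_xv; rewrite /sigma_through /geodesics d2.
have [xK|xK] := boolP (x \in common u v).
  (* Tuples omit the starting vertex, so [[tuple x; v]] encodes the only path from [u] to [v] with
     middle vertex [x]. *)
  apply/eqP/cards1P; exists [tuple x; v]; apply/setP=> -[[|y [|z []]] //= sz].
  rewrite !inE /upath /= !inE -val_eqE /= (negbTE neq_xu) /=.
  rewrite !eqseq_cons andbT; move: xK; rewrite inE => /andP[ux xv].
  case: (eqVneq z v) => [->|_]; rewrite ?andbF //= !andbT (negbTE neq_xv) orbF.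
  rewrite (eq_sym x y); case: (eqVneq y x) => [->|_]; rewrite ?andbF //.
  by rewrite ux xv (eq_sym u x) (negbTE neq_xu) (negbTE neq_uv) neq_xv.
apply/eqP; rewrite cards_eq0; apply/eqP/setP=> -[[|y [|z []]] //= sz].
rewrite !inE /upath /= !inE (negbTE neq_xu) /=; apply/negP.
case/andP=> /and3P[/and3P[uy yz _] /eqP ezv _] /orP[] /eqP ex; subst.
  by rewrite inE uy yz in xK.
by rewrite eqxx in neq_xv.
Qed.

Lemma sigma2 u v : dist u v = 2 -> u != v -> sigma u v = #|common u v|.
Proof.
move=> d2 neq_uv; rewrite /sigma /geodesics d2.
rewrite -(@card_imset _ _ (fun w => [tuple w; v])) => [|y z [] //].
congr #|pred_of_set _|; apply/setP=> -[[|y [|z []]] //= sz].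
rewrite inE; apply/idP/imsetP => [|[w]].
  case/and3P=> /and3P[uy yz _] /eqP /= ezv _; subst z.
  by exists y; [rewrite inE uy yz | apply: val_inj].
rewrite inE => /andP[uw wv] [-> ->]; rewrite /upath /= uw wv eqxx !inE /=.
rewrite negb_or neq_uv !andbT; apply/andP; split; apply/eqP => e; subst.
  by rewrite adj_irrefl in uw.
by rewrite adj_irrefl in wv.
Qed.

End Distance.

(** * Counting unordered pairs of vertices *)

Section OrderedPairs.

Variable T : finType.
Implicit Types (X Y S : {set T}) (e : T * T).

(** Selects the same representative of an unordered pair as the sum in [betweenness]. *)
Definition ordered e := enum_rank e.1 < enum_rank e.2.

Lemma ordered_neq e : ordered e -> e.1 != e.2.
Proof. by apply: contraTneq => eq12; rewrite /ordered eq12 ltnn. Qed.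

Definition cross X Y e :=
  ((e.1 \in X) && (e.2 \in Y)) || ((e.1 \in Y) && (e.2 \in X)).

Lemma card_cross X Y : [disjoint X & Y] ->
  #|X| * #|Y| <= #|[set e | ordered e && cross X Y e]|.
Proof.
move=> dXY; rewrite -cardsX.
(* [f] replaces a pair by its selected representative. Disjointness of [X] and [Y] reveals which
   entry came from [X], so [f] is injective on their product. *)
pose f e := if ordered e then e else (e.2, e.1).
have XnY x : x \in X -> x \in Y -> False.
  by move=> xX xY; move/pred0P/(_ x): dXY; rewrite /= xX xY.
rewrite -(@card_in_imset _ _ f) => [|[x y] [x' y']]; last first.
  rewrite !inE /= => /andP[xX yY] /andP[x'X y'Y]; rewrite /f.
  case: ifP => _; case: ifP => _ //= -[e1 e2]; subst => //.
    by case: (XnY y').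
  by case: (XnY x').
apply/subset_leq_card/subsetP => _ /imsetP[[x y] /setXP[/= xX yY] ->].
have neq_xy : x != y by apply/eqP => exy; apply: (XnY x); rewrite // exy.
rewrite inE /f /cross; case: ifPn => [->|] /=; first by rewrite xX yY.
rewrite xX yY orbT andbT /ordered /= -leqNgt leq_eqVlt => /orP[|//].
by move=> /eqP/val_inj/enum_rank_inj exy; rewrite exy eqxx in neq_xy.
Qed.

(** The selected pairs and their swaps form two disjoint families of equal size in the square of
    [S]. *)
Lemma card_ordered S :
  2 * #|[set e | [&& ordered e, e.1 \in S & e.2 \in S]]| <= #|S| ^ 2.
Proof.
set O := [set e | _]; pose swap e : T * T := (e.2, e.1).
have swap_inj : injective swap by move=> [? ?] [? ?] [-> ->].
have dOO : [disjoint O & swap @: O].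
  apply/pred0P => e /=; apply/negP => /andP[eO /imsetP[e' e'O def_e]].
  move: eO e'O; rewrite def_e !inE /ordered /= => /andP[lt1 _] /andP[lt2 _].
  by rewrite ltnNge ltnW in lt1.
rewrite -mulnn -cardsX mul2n -addnn -{2}(card_imset O swap_inj).
have := leq_card_setU O (swap @: O); case=> _; rewrite dOO => /eqP <-.
apply/subset_leq_card/subsetP => e; rewrite inE => /orP[|/imsetP[e' + ->]].
  by rewrite !inE => /and3P[_ -> ->].
by rewrite !inE => /and3P[_ -> ->].
Qed.

End OrderedPairs.

Local Open Scope ring_scope.

(** * The contribution of a single pair to betweenness *)

Section PathFraction.

Variable G : sgraph.
Implicit Types (u v x : G) (M : {set G}).

Definition path_fraction u v x : rat :=
  (sigma_through u v x)%:R / (sigma u v)%:R.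

Lemma path_fraction_ge0 u v x : 0 <= path_fraction u v x.
Proof. by rewrite divr_ge0 ?ler0n. Qed.

Lemma betweennessE x : betweenness x =
  \sum_(e : G * G | [&& ordered e, e.1 != x & e.2 != x])
    path_fraction e.1 e.2 x.
Proof.
rewrite /betweenness pair_big_dep /=; apply: eq_bigl => e.
by rewrite andbA andbC.
Qed.

(** Double counting: every shortest path from [u] to [v] meets [M], so it is counted at least once
    when [sigma_through] is summed over [M]. *)
Lemma path_fraction_sum_ge1 u v M : connect adj u v ->
  (forall p, path adj u p -> last u p = v -> has (mem M) (u :: p)) ->
  1 <= \sum_(x in M) path_fraction u v x.
Proof.
move=> cuv hitM; rewrite -mulr_suml ler_pdivlMr ?ltr0n ?sigma_gt0 //.
rewrite mul1r -natr_sum ler_nat.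
have throughE x : sigma_through u v x
    = (\sum_(p in geodesics u v) (x \in u :: p))%N.
  rewrite /sigma_through -sum1dep_card big_mkcondr.
  by apply: eq_bigr => p _; case: ifP.
under eq_bigr do rewrite throughE.
rewrite exchange_big /sigma -sum1_card. apply: leq_sum => p.
rewrite inE => /and3P[pP /eqP lastp _].
have /hasP[x xp xM] := hitM p pP lastp.
by rewrite (bigD1 x) //= xp.
Qed.

Hypothesis connG : connected_graph G.

Lemma path_fraction_adj u v x :
  adj u v -> x != u -> x != v -> path_fraction u v x = 0.
Proof.
move=> uv xu xv; rewrite /path_fraction.
have [->|/sigma_through_dist] := posnP (sigma_through u v x).
  by rewrite mul0r.
have := dist_adj_le uv.
have := dist_gt0 (connG u x); rewrite eq_sym => /(_ xu).
by have := dist_gt0 (connG x v) xv; lia.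
Qed.

Lemma path_fraction_common u v x : u != v -> ~~ adj u v ->
  x \in common u v -> path_fraction u v x = #|common u v|%:R^-1.
Proof.
move=> uv nuv xK; have d2 := dist2 (connG u v) uv nuv xK.
have /andP[xu xv] : (x != u) && (x != v).
  move: (xK); rewrite inE => /andP[ux xv].
  by apply/andP; split; apply/eqP => e; subst; rewrite adj_irrefl in ux xv.
by rewrite /path_fraction sigma_through2 // sigma2 // xK mul1r.
Qed.

End PathFraction.

(** Deletes [q] by isolating it, which keeps the vertex type: [q] separates two other vertices when
    [connect (avoid q)] fails between them. *)
Definition avoid (G : sgraph) (q : G) : rel G :=
  [rel i j | [&& adj i j, i != q & j != q]].

(** * Connectivity and distances in a blow-up *)

Section BlowUp.

Variables (G : sgraph) (H : G -> sgraph).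
Hypothesis H_gt0 : forall i, (0 < #|H i|)%N.

Notation V := (blowup H).
Implicit Types (u v w x : V) (i j l p q : G) (I : {set G}).

Lemma blowup_adjT u v : adj (tag u) (tag v) -> adj u v.
Proof.
rewrite /= /blowup_adj; case: eqP => // e; rewrite -e.
by rewrite [adj (tag u) _]adj_irrefl.
Qed.

Lemma blowup_adj_tag u v : adj u v -> tag v != tag u -> adj (tag u) (tag v).
Proof. by rewrite /= /blowup_adj eq_sym; case: ifP. Qed.

Lemma adj_neq i j : adj i j -> i != j.
Proof. by apply: contraTneq => ->; rewrite adj_irrefl. Qed.

Definition pick_block i : V :=
  Tagged (fun i => H i : Type) (xchoose (elimT card_gt0P (H_gt0 i))).

Lemma blowup_connected i0 j0 :
  connected_graph G -> adj i0 j0 -> connected_graph V.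
Proof.
move=> connG ij0 u v.
have lift s u' : s != [::] -> path adj (tag u') s -> last (tag u') s = tag v ->
    connect adj u' v.
  elim: s u' => // i [|j s] IHs u' _ /= /andP[ui].
    by move=> _ ei; apply/connect1/blowup_adjT; rewrite -ei.
  move=> sP ls; apply: (connect_trans (y := pick_block i)).
    exact/connect1/blowup_adjT.
  exact: IHs.
have /connectP[s1 s1P e1] := connG (tag u) i0.
have /connectP[s2 s2P e2] := connG i0 (tag v).
(* The detour over the edge from [i0] to [j0] keeps the walk nonempty even when [u] and [v] lie in
   one block. *)
apply: (lift (s1 ++ j0 :: i0 :: s2)); first by case: (s1).
  by rewrite cat_path s1P /= -e1 ij0 adj_sym ij0.
by rewrite last_cat /= -e2.
Qed.

(** Projecting to tags turns each step between blocks into an edge of [G] and collapses each step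
    inside a block. *)
Lemma path_avoid q u s : path adj u s -> all (fun x => tag x != q) (u :: s) ->
  connect (avoid q) (tag u) (tag (last u s)).
Proof.
elim: s u => [|v s IHs] u /=; first by rewrite connect0.
case/andP=> uv sP /and3P[uq vq sq].
apply: connect_trans (IHs v sP _); last by rewrite /= vq.
have [->|vu] := eqVneq (tag v) (tag u); first exact: connect0.
by apply: connect1; rewrite /avoid /= uq vq blowup_adj_tag.
Qed.

Definition block I : {set V} := [set u | tag u \in I].

Lemma card_block I : #|block I| = (\sum_(i in I) #|H i|)%N.
Proof.
rewrite /block -sum1dep_card.
transitivity (\sum_(i in I) \sum_(a : H i) 1)%N; last first.
  by apply: eq_bigr => i _; rewrite sum1_card.
by rewrite sig_big_dep /=; apply: eq_bigl => u; rewrite andbT.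
Qed.

Lemma card_block1 i : #|block [set i]| = #|H i|.
Proof. by rewrite card_block big_set1. Qed.

Hypothesis connV : connected_graph V.

(** [w] is the first vertex outside the block of [x] on a shortest path to [v]. *)
Lemma dist_exit x v : tag v != tag x ->
  exists2 w : V, adj (tag x) (tag w) & (dist w v < dist x v)%N.
Proof.
have [s [sP <- <-]] := dist_walk (connV x v).
elim: s x sP => [|y s IHs] x /=; first by rewrite eqxx.
case/andP=> xy sP nvx; have [eyx|nyx] := eqVneq (tag y) (tag x).
  rewrite -eyx in nvx *; have [w yw lew] := IHs y sP nvx.
  by exists w; rewrite // ltnS ltnW.
by exists y; [apply: blowup_adj_tag | rewrite ltnS; apply: dist_le_path].
Qed.

(** Vertices of one block have the same neighbours outside it, so [u'] can continue from the vertex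
    at which a shortest path from [u] leaves the block. *)
Lemma dist_twin u u' v : tag u' = tag u -> tag v != tag u ->
  (dist u' v <= dist u v)%N.
Proof.
move=> eu vu; have [w uw] := dist_exit vu; apply: leq_trans.
rewrite -add1n; apply: leq_trans (dist_triangle (connV u' w) (connV w v)) _.
by rewrite leq_add2r; apply/dist_adj_le/blowup_adjT; rewrite eu.
Qed.

Lemma dist_sym u v : dist u v = dist v u.
Proof. by apply/eqP; rewrite eqn_leq !dist_sym_le. Qed.

Variables (l p : G).
Hypothesis leaf_l : forall i, adj l i = (i == p).

Let neq_pl : p != l.
Proof. by rewrite eq_sym; apply: adj_neq; rewrite leaf_l. Qed.

(** Every exit from block [l] enters block [p], whose vertices are interchangeable as seen from
    other blocks. A visit to [x] is therefore a wasted detour unless both ends lie in block [l] or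
    both in block [p]. *)
Lemma leaf_through u v x : tag x = l -> u != x -> v != x ->
  (0 < sigma_through u v x)%N ->
  (tag u = l /\ tag v = l) \/ (tag u = p /\ tag v = p).
Proof.
move=> xl ux vx /sigma_through_dist.
have /= ux0 := dist_gt0 (connV u x) ux.
have /= vx0 := dist_gt0 (connV v x) vx.
rewrite [dist x v]dist_sym => le_d.
have exit (y : V) :
    tag y != l -> exists2 w : V, tag w = p & (dist w y < dist x y)%N.
  move=> yl; have [|w] := @dist_exit x y; first by rewrite xl.
  by rewrite xl leaf_l => /eqP; exists w.
have far (y z : V) : tag y != l -> tag y != p -> tag z != l ->
    (dist y z < dist y x + dist z x)%N.
  move=> yl yp zl.
  (* Both exits [w] and [w'] lie in block [p]; passing through [w'] alone is shorter than passing
     through [x]. *)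
  have [w wp lt_w] := exit y yl; have [w' wp' lt_w'] := exit z zl.
  have tw : (dist w' y <= dist w y)%N by apply: dist_twin; rewrite wp ?wp'.
  have := dist_triangle (connV y w') (connV w' z).
  rewrite [dist y w']dist_sym [dist y x]dist_sym [dist z x]dist_sym /=; lia.
have [ul|ul] := eqVneq (tag u) l; have [vl|vl] := eqVneq (tag v) l.
- by left.
(* [u] and [x] are twins, so [u] is as close to [v] as [x] is, and going first to [x] costs
   extra. *)
- have : (dist u v <= dist x v)%N by apply: dist_twin; rewrite ?xl.
  by rewrite [dist x v]dist_sym; lia.
- have : (dist v u <= dist x u)%N by apply: dist_twin; rewrite ?xl.
  by rewrite [dist x u]dist_sym [dist v u]dist_sym; lia.
have [up|up] := eqVneq (tag u) p; last by have := far u v ul up vl; lia.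
have [vp|vp] := eqVneq (tag v) p; first by right.
by have := far v u vl vp ul; rewrite [dist v u]dist_sym; lia.
Qed.

End BlowUp.

(** * Bounds on the total betweenness of a block *)

Section BlowUpSums.
Variables (G : sgraph) (H : G -> sgraph).
Hypothesis H_gt0 : forall i, (0 < #|H i|)%N.

Notation V := (blowup H).
Implicit Types (u v w x : V) (e : V * V) (i j l p q : G) (I : {set G}).
Hypothesis connV : connected_graph V.

(** Adjacent pairs are left out because their shortest path has no inner vertex. *)
Definition gap_in j e :=
  [&& ordered e, tag e.1 == j, tag e.2 == j & ~~ adj e.1 e.2].

(* The betweenness that a vertex of a block adjacent to block [j] receives from
   the pairs inside block [j]. *)
Definition gap_load j : rat :=
  \sum_(e : V * V | gap_in j e) #|common e.1 e.2|%:R^-1.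

Lemma common_adj i j u v x : adj i j -> tag u = j -> tag v = j -> tag x = i ->
  x \in common u v.
Proof.
move=> ij uj vj xi; rewrite inE; apply/andP; split; apply: blowup_adjT.
  by rewrite uj xi adj_sym.
by rewrite vj xi.
Qed.

Lemma gap_in_card j : (2 * #|[set e | gap_in j e]| <= #|H j| ^ 2)%N.
Proof.
rewrite -card_block1; apply: leq_trans (card_ordered _).
rewrite leq_mul2l /=; apply/subset_leq_card/subsetP => e; rewrite !inE.
by case/and4P=> -> /eqP-> /eqP->; rewrite eqxx.
Qed.

(** All of [block H I] consists of common neighbours, which bounds each term; [gap_in_card] bounds
    the number of terms. *)
Lemma gap_load_le j I :
    (forall i, i \in I -> adj i j) -> (0 < #|block H I|)%N ->
  gap_load j <= #|H j|%:R ^+ 2 / (2 * #|block H I|%:R).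
Proof.
move=> adjI I_gt0.
apply: (@le_trans _ _ (\sum_(e | gap_in j e) #|block H I|%:R^-1)).
  apply: ler_sum => e /and4P[_ /eqP e1 /eqP e2 _].
  have leIK : (#|block H I| <= #|common e.1 e.2|)%N.
    apply/subset_leq_card/subsetP => x; rewrite [_ \in block _ _]inE => xI.
    exact: common_adj (adjI _ xI) e1 e2 _.
  by rewrite lef_pV2 ?posrE ?ltr0n ?ler_nat // (leq_trans I_gt0).
rewrite sumr_const invfM mulrA -[leLHS]mulr_natl.
rewrite ler_wpM2r ?invr_ge0 ?ler0n //.
rewrite ler_pdivlMr // mulrC -natrX -natrM ler_nat.
by have := gap_in_card j; rewrite cardsE.
Qed.

(** Two disjoint families of pairs contribute: each gap of block [j] gives its full term to every
    vertex of block [i], and each pair across [X] and [Y] gives at least one in total, since block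
    [i] separates them. *)
Lemma betweenness_ge i j (X Y : {set V}) : adj i j ->
    [disjoint X & Y] -> [disjoint X & block H [set i]] ->
    [disjoint Y & block H [set i]] -> [disjoint Y & block H [set j]] ->
    (forall u v s, u \in X -> v \in Y -> path adj u s -> last u s = v ->
       has (mem (block H [set i])) (u :: s)) ->
  #|H i|%:R * gap_load j + (#|X| * #|Y|)%:R
    <= \sum_(x in block H [set i]) betweenness x.
Proof.
move=> ij dXY dXi dYi dYj sepXY.
have not_both (A B : {set V}) x :
    [disjoint A & B] -> x \in A -> x \in B -> False.
  by move=> dAB xA xB; move/pred0P/(_ x): dAB; rewrite /= xA xB.
pose C e := ordered e && cross X Y e.
have leC : (#|X| * #|Y|)%:R
    <= \sum_(x in block H [set i]) \sum_(e | C e) path_fraction e.1 e.2 x.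
  rewrite exchange_big /=.
  apply: (@le_trans _ _ (\sum_(e | C e) 1)).
    by rewrite sumr_const ler_nat; have := card_cross dXY; rewrite cardsE.
  apply: ler_sum => e /andP[_ Ce].
  apply: (@path_fraction_sum_ge1 (blowup H) e.1 e.2 (block H [set i]));
    [exact: connV | move=> s sP ls].
  case/orP: Ce => /andP[e1 e2]; first exact: (sepXY _ _ s e1 e2 sP).
  (* The separation hypothesis runs from [X] to [Y], so a path in the other direction is reversed
     first. *)
  have := sepXY e.2 e.1 (rev (belast e.1 s)) e2 e1.
  have memr : has (mem (block H [set i])) (e.2 :: rev (belast e.1 s))
      = has (mem (block H [set i])) (e.1 :: s).
    by rewrite -(has_rev _ (e.1 :: s)) (lastI e.1 s) rev_rcons ls.
  rewrite memr; apply.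
    rewrite -ls rev_path (eq_path (e' := adj)) // => y z; exact: adj_sym.
  by case: (s) ls => //= y s' _; rewrite rev_cons last_rcons.
apply: le_trans (lerD (lexx _) leC) _.
rewrite mulr_natl -(card_block1 H) -sumr_const -big_split /=.
apply: ler_sum => x; rewrite inE => /set1P xi; rewrite betweennessE.
rewrite /gap_load big_mkcond [X in _ + X]big_mkcond [leRHS]big_mkcond.
rewrite -big_split; apply: ler_sum => e _ /=.
have nji y : tag y == j -> y != x.
  by apply: contraTneq => ->; rewrite xi adj_neq.
have xB : x \in block H [set i] by rewrite inE xi set11.
have [gap|_] := boolP (gap_in j e); last first.
  rewrite add0r; case: ifPn => [/andP[-> Ce]|_]; last first.
    by case: ifP => // _; apply: path_fraction_ge0.
  suff /andP[-> ->] : (e.1 != x) && (e.2 != x) by [].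
  have notXY : x \notin X /\ x \notin Y.
    by split; apply/negP => xXY;
      [exact: not_both dXi xXY xB | exact: not_both dYi xXY xB].
  case: notXY => /negPf xX /negPf xY.
  by apply/andP; split; apply/eqP => ex; move: Ce;
    rewrite /cross ex xX xY /= ?andbF.
(* Both ends of a gap lie in block [j], which misses [Y]; hence the two families do not overlap. *)
have /negbTE-> : ~~ C e.
  apply/negP=> /andP[_]; case/and4P: gap => _ e1 e2 _.
  by case/orP=> /andP[eX eY];
    [apply: (not_both _ _ e.2 dYj) | apply: (not_both _ _ e.1 dYj)];
    rewrite // !inE.
case/and4P: gap => oe e1 e2 nadj; rewrite oe !nji //= addr0.
rewrite path_fraction_common ?ordered_neq //.
exact: common_adj ij (eqP e1) (eqP e2) xi.
Qed.

Variables (l p : G).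
Hypothesis leaf_l : forall i, adj l i = (i == p).

(** By [leaf_through], only pairs inside block [p] or block [l] can contribute. The nonadjacent ones
    have distance two, so each contributes the inverse of its number of common neighbours. *)
Lemma betweenness_leaf_le x : tag x = l ->
  betweenness x <= gap_load p +
    \sum_(e : V * V | gap_in l e && (x \in common e.1 e.2))
       #|common e.1 e.2|%:R^-1.
Proof.
move=> xl; have lp : adj l p by rewrite leaf_l.
rewrite betweennessE /gap_load big_mkcond [X in _ + X]big_mkcond.
rewrite [X in X + _]big_mkcond -big_split; apply: ler_sum => e _ /=.
have inv_ge0 (b : bool) :
    0 <= (if b then #|common e.1 e.2|%:R^-1 else 0) :> rat.
  by case: b; rewrite ?invr_ge0 ?ler0n.
case: ifP => [/and3P[oe e1x e2x]|_]; last by rewrite addr_ge0.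
have [through0|through] := posnP (sigma_through e.1 e.2 x).
  by rewrite /path_fraction through0 mul0r addr_ge0.
have nadj : ~~ adj e.1 e.2.
  apply/negP=> /(path_fraction_adj connV) /(_ _) frac0.
  have /eqP : path_fraction e.1 e.2 x = 0 by apply: frac0; rewrite eq_sym.
  rewrite mulf_eq0 invr_eq0 !pnatr_eq0.
  by rewrite (gtn_eqF through) (gtn_eqF (sigma_gt0 (connV _ _))).
have neq_e := ordered_neq oe.
have xK : x \in common e.1 e.2.
  have [[e1 e2]|[e1 e2]] := leaf_through connV leaf_l xl e1x e2x through.
    have yK : pick_block H_gt0 p \in common e.1 e.2.
      by apply: common_adj e1 e2 _; rewrite // adj_sym.
    have d2 := dist2 (connV _ _) neq_e nadj yK.
    by rewrite sigma_through2 // 1?eq_sym // lt0b in through.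
  exact: common_adj lp e1 e2 xl.
rewrite (path_fraction_common connV neq_e nadj xK) xK andbT.
rewrite /gap_in oe nadj !andbT.
have [[-> ->]|[-> ->]] := leaf_through connV leaf_l xl e1x e2x through.
  by rewrite eqxx /= lerDr.
by rewrite eqxx /= lerDl.
Qed.

(** After exchanging the sums, a gap of block [l] with [c] common neighbours inside the block
    contributes at most [c / (c + b)], because all of block [p] is common too. As [c <= a], this is
    at most [a / (a + b)], and there are at most [a ^ 2 / 2] gaps. *)
Lemma betweenness_leaf_sum_le :
  \sum_(x in block H [set l]) betweenness x
    <= #|H l|%:R * gap_load p + #|H l|%:R ^+ 3 / (2 * (#|H l| + #|H p|)%:R).
Proof.
set a := #|H l|; set b := #|H p|.
have a_gt0 : 0 < a%:R :> rat by rewrite ltr0n H_gt0.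
have b_gt0 : 0 < b%:R :> rat by rewrite ltr0n H_gt0.
have lp : adj l p by rewrite leaf_l.
pose K e := #|common e.1 e.2|.
have local : \sum_(x in block H [set l])
    \sum_(e : V * V | gap_in l e && (x \in common e.1 e.2)) (K e)%:R^-1
    <= a%:R ^+ 3 / (2 * (a + b)%:R) :> rat.
  under eq_bigr => x _ do rewrite big_mkcondr.
  rewrite exchange_big /=.
  apply: (@le_trans _ _ (\sum_(e | gap_in l e) a%:R / (a + b)%:R)).
    apply: ler_sum => e /and4P[_ /eqP e1 /eqP e2 _].
    rewrite -big_mkcondr /=; under eq_bigl do rewrite -in_setI.
    rewrite sumr_const.
    set c := #|_|.
    have le_ca : (c <= a)%N.
      rewrite /a -(card_block1 H); apply/subset_leq_card/subsetP => y.
      by case/setIP.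
    have le_cbK : (c + b <= K e)%N.
      rewrite /b -(card_block1 H) /K.
      rewrite -(cardsID (block H [set p]) (@common (blowup H) e.1 e.2)) addnC.
      apply: leq_add; apply/subset_leq_card/subsetP => y.
        move=> yp; rewrite inE yp andbT; move: yp; rewrite inE => /set1P.
        by apply: common_adj e1 e2; rewrite adj_sym.
      case/setIP=> + yK; rewrite !inE in yK * => /eqP ->; rewrite yK andbT.
      by rewrite (adj_neq lp).
    rewrite -[leLHS]mulr_natl ler_pdivrMr ?ltr0n; last first.
      by apply: leq_trans le_cbK; rewrite addn_gt0 H_gt0 orbT.
    rewrite mulrAC ler_pdivlMr; last by rewrite ltr0n addn_gt0 H_gt0.
    rewrite -!natrM ler_nat mulnDr; nia.
  rewrite sumr_const -[leLHS]mulr_natl.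
  have := gap_in_card l; rewrite cardsE -/a -(ler_nat rat) natrM natrX => le2.
  rewrite mulrA ler_pdivrMr ?natrD ?addr_gt0 //.
  have -> : a%:R ^+ 3 / (2 * (a%:R + b%:R)) * (a%:R + b%:R)
      = a%:R ^+ 2 / 2 * a%:R :> rat.
    by field; rewrite -natrD pnatr_eq0 -lt0n addn_gt0 H_gt0.
  rewrite ler_pM2r //; lra.
apply: (@le_trans _ _ (\sum_(x in block H [set l]) (gap_load p +
    \sum_(e : V * V | gap_in l e && (x \in common e.1 e.2)) (K e)%:R^-1))).
  by apply: ler_sum => x; rewrite inE => /set1P; apply: betweenness_leaf_le.
rewrite big_split; apply: lerD local.
by rewrite sumr_const (card_block1 H) -[leLHS]mulr_natl.
Qed.

End BlowUpSums.

Lemma avoid_sym (G : sgraph) (q : G) : symmetric (avoid q).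
Proof. by move=> i j; rewrite /avoid /= adj_sym [(i != q) && _]andbC. Qed.

(** * The numerical inequalities *)

Lemma end_arith (a b c z : nat) : (0 < a)%N -> (0 < b)%N ->
  (2 * (a + b) ^ 2 * z <= c * a ^ 2)%N ->
  a%:R * c%:R <= b%:R * (b%:R ^+ 2 / (2 * (a + c)%:R)
                         + a%:R ^+ 2 / (2 * (a + b)%:R)) :> rat ->
  (2 * z < a + b)%N.
Proof.
(* If [a + b <= 2 * z], the first inequality gives [(a + b) ^ 3 <= c * a ^ 2], hence [a + b <= c].
   The second then gives [a * c * (a + c) <= b ^ 3], and the chain [c * a ^ 2 <= a * c * (a + c) <=
   b ^ 3 < (a + b) ^ 3] is contradictory. *)
move=> a_gt0 b_gt0 leI leII; rewrite ltnNge; apply/negP => le_z.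
have le3 : ((a + b) ^ 3 <= c * a ^ 2)%N.
  apply: leq_trans leI; rewrite mulnAC expnSr mulnC.
  by apply: leq_mul.
have le_c : (a + b <= c)%N.
  rewrite -(@leq_pmul2r (a ^ 2)) ?expn_gt0 ?a_gt0 //.
  apply: leq_trans le3; rewrite [leqRHS]expnS leq_mul2l leq_exp2r // leq_addr.
  by rewrite orbT.
have {}leII : (2 * (a * c) * ((a + c) * (a + b))
    <= b ^ 3 * (a + b) + a ^ 2 * b * (a + c))%N.
  rewrite -(ler_nat rat) !(natrD, natrM, natrX).
  have a0 : 0 < a%:R :> rat by rewrite ltr0n.
  have b0 : 0 < b%:R :> rat by rewrite ltr0n.
  have c0 : 0 <= c%:R :> rat by rewrite ler0n.
  have ac0 : 0 < a%:R + c%:R :> rat by lra.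
  have ab0 : 0 < a%:R + b%:R :> rat by lra.
  rewrite !natrD in leII.
  have pos : 0 < 2 * ((a%:R + c%:R) * (a%:R + b%:R)) :> rat.
    by rewrite !mulr_gt0.
  rewrite -(ler_pM2r pos) in leII.
  apply: le_trans (le_trans leII _); first lra.
  rewrite le_eqVlt; apply/orP; left; apply/eqP; field.
  by rewrite !lt0r_neq0.
have le_ac2 : (2 * (a * c * (a + c)) <= b ^ 3 + a * (b * (a + c)))%N.
  rewrite -(@leq_pmul2r (a + b)) ?addn_gt0 ?a_gt0 //.
  have -> : (2 * (a * c * (a + c)) * (a + b)
             = 2 * (a * c) * ((a + c) * (a + b)))%N by ring.
  apply: leq_trans leII _; rewrite mulnDl leq_add2l.
  have -> : (a ^ 2 * b * (a + c) = a * (b * (a + c)) * a)%N by ring.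
  by rewrite leq_mul2l leq_addr orbT.
have le_b : (a * (b * (a + c)) <= a * c * (a + c))%N.
  by rewrite -mulnA leq_mul2l leq_mul2r (leq_trans (leq_addl a b) le_c) !orbT.
have lt_b3 : (b ^ 3 < (a + b) ^ 3)%N.
  by rewrite ltn_exp2r // -{1}[b]add0n ltn_add2r.
have le_a : (c * a ^ 2 <= a * c * (a + c))%N.
  by rewrite expnS expn1 mulnA [(c * a)%N]mulnC leq_mul2l leq_addr orbT.
move: (a * c * (a + c))%N (b ^ 3)%N ((a + b) ^ 3)%N (a * (b * (a + c)))%N
  (c * a ^ 2)%N le3 le_ac2 le_b lt_b3 le_a; lia.
Qed.

(** Discarding [b] and [b'] from the squared sums yields [2 * a' <= b'] and [2 * a <= b], so
    [4 * (a * a') <= b * b']. Discarding [a] and [a'] instead and multiplying yields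
    [4 * (b * b') <= a * a']. *)
Lemma two_end_arith (a b a' b' : nat) : (0 < a)%N -> (0 < b)%N ->
  (0 < a')%N -> (0 < b')%N ->
  (2 * (a + b) ^ 2 * a' <= b' * a ^ 2)%N ->
  (2 * (a' + b') ^ 2 * a <= b * a' ^ 2)%N -> False.
Proof.
have aux x y x' y' : (0 < x)%N -> (2 * (x + y) ^ 2 * x' <= y' * x ^ 2)%N ->
    (2 * x' <= y')%N /\ (2 * y ^ 2 * x' <= y' * x ^ 2)%N.
  move=> x_gt0 le_xy; split.
    rewrite -(@leq_pmul2r (x ^ 2)) ?expn_gt0 ?x_gt0 //.
    apply: leq_trans le_xy; rewrite mulnAC leq_mul2r leq_mul2l leq_exp2r //.
    by rewrite leq_addr !orbT.
  apply: leq_trans le_xy; rewrite leq_mul2r leq_mul2l leq_exp2r //.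
  by rewrite leq_addl !orbT.
move=> a0 b0 a'0 b'0 /aux[//|le1 le2] /aux[//|le3 le4].
have := leq_mul le2 le4.
have -> : (2 * b ^ 2 * a' * (2 * b' ^ 2 * a)
           = (4 * (b * b')) * (b * b' * (a * a')))%N by ring.
have -> : (b' * a ^ 2 * (b * a' ^ 2)
           = (a * a') * (b * b' * (a * a')))%N by ring.
rewrite leq_pmul2r ?muln_gt0 ?a0 ?b0 ?a'0 ?b'0 //.
have : (0 < a * a')%N by rewrite muln_gt0 a0.
have := leq_mul le1 le3; rewrite [(b' * b)%N]mulnC.
have -> : (2 * a' * (2 * a) = 4 * (a * a'))%N by ring.
move: (a * a')%N (b * b')%N; lia.
Qed.

(** * Separation and longest paths in acyclic graphs *)

Section Tree.

Variable G : sgraph.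
Hypothesis acycG : acyclic G.
Implicit Types (i w q : G) (L s : seq G).

(** Otherwise a path from [p] to the successor of [q] that avoids [q] would close up through [q] to
    a cycle of length at least three. *)
Lemma tree_separates x p q s w : sorted adj [:: x, p, q & s] ->
  uniq [:: x, p, q & s] -> w \in s -> ~~ connect (avoid q) p w.
Proof.
case: s => // y s /= /and4P[xp pq qy sP] /and4P[_ pU qys _] ws.
have yw : connect (avoid q) y w.
  case/splitPl: ws sP qys => s1 s2 <- sP qys.
  apply/connectP; exists s1 => //.
  have : path adj y s1 by move: sP; rewrite cat_path => /andP[].
  have : all (fun z => z != q) (y :: s1).
    apply/allP => z zs1; apply: contraNneq qys => <-.
    by rewrite -cat_cons mem_cat zs1.
  elim: (s1) (y) => //= z s' IHs u /and3P[uq zq sq] /andP[uz s'P].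
  by rewrite /avoid /= uz uq zq IHs //= zq.
apply/negP => pw; have {yw pw} : connect (avoid q) p y.
  apply: connect_trans pw _.
  by rewrite (sym_connect_sym (@avoid_sym _ q)).
case/connectP => _ /shortenP[[|z t] tP tU _] ey.
  by move: pU; rewrite ey /= !inE eqxx orbT.
have /acycG : ucycle adj [:: q, p, z & t]; last by [].
have qt : q \notin [:: p, z & t].
  apply/negP; rewrite in_cons => /orP[/eqP eqp|].
    by move: pq; rewrite eqp adj_irrefl.
  elim: (z :: t) (p) tP => //= u r IHr v /andP[/and3P[_ _ uq] rP].
  by rewrite in_cons eq_sym (negbTE uq); apply: IHr rP.
apply/andP; split; last by rewrite cons_uniq qt.
rewrite /= in ey; rewrite /cycle rcons_path /= -ey [adj y q]adj_sym qy andbT.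
rewrite [adj q p]adj_sym pq /=.
by apply: (sub_path _ tP) => u v /and3P[].
Qed.

Definition longest L := [/\ sorted adj L, uniq L &
  forall L', sorted adj L' -> uniq L' -> (size L' <= size L)%N].

Lemma longest_exists L0 : sorted adj L0 -> uniq L0 ->
  exists2 L, longest L & (size L0 <= size L)%N.
Proof.
move=> sL0 uL0; pose P n := [exists t : n.-tuple G, sorted adj t && uniq t].
have exP : exists n, P n.
  by exists (size L0); apply/existsP; exists (in_tuple L0); rewrite sL0 uL0.
have ubP n : P n -> (n <= #|G|)%N.
  case/existsP=> t /andP[_ /card_uniqP]; rewrite size_tuple => <-.
  exact: max_card.
case: (ex_maxnP exP ubP) => n /existsP[t /andP[tP tU]] maxn.
have maxL L' : sorted adj L' -> uniq L' -> (size L' <= n)%N.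
  by move=> sL uL; apply/maxn/existsP; exists (in_tuple L'); rewrite sL uL.
exists t; last by rewrite size_tuple maxL.
by split=> // L'; rewrite size_tuple; apply: maxL.
Qed.

Lemma longest_rev L : longest L -> longest (rev L).
Proof.
case=> sL uL maxL; split; rewrite ?rev_uniq ?size_rev //.
by rewrite rev_sorted (eq_sorted (e' := adj)) // => x y; apply: adj_sym.
Qed.

(** A further neighbour of [l] would either extend the path or lie on it and close a cycle. *)
Lemma longest_leaf l p L :
  longest [:: l, p & L] -> forall i, adj l i = (i == p).
Proof.
case=> sL lU maxL; have /= /andP[lp pP] := sL.
move=> i; apply/idP/eqP => [li|->] //.
apply/eqP; apply: contraT => ip.
have [iL|iL] := boolP (i \in [:: l, p & L]); last first.
  have := maxL [:: i, l, p & L]; rewrite cons_uniq iL lU /= lp pP adj_sym li.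
  by move=> /(_ isT isT); rewrite ltnn.
have {iL} : i \in L.
  move: iL; rewrite !in_cons (negbTE ip) => /or3P[/eqP eil||] //.
  by rewrite eil adj_irrefl in li.
move=> /splitPr iL; case: iL pP lU {sL maxL} => L1 L2.
rewrite -cat_rcons cat_path -!cat_cons cat_uniq => /andP[pP _] /andP[lU _].
have /acycG : ucycle adj [:: l, p & rcons L1 i]; last by rewrite /= size_rcons.
apply/andP; split=> //=.
by rewrite lp rcons_path pP last_rcons adj_sym.
Qed.

End Tree.

(** * Inequalities forced by uniformity near a leaf *)

Section Uniform.

Variables (G : sgraph) (H : G -> sgraph).
Hypothesis H_gt0 : forall i, (0 < #|H i|)%N.
Notation V := (blowup H).
Hypothesis connV : connected_graph V.
Variable beta : rat.
Hypothesis betaP : forall x : V, betweenness x = beta.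
Implicit Types (i l p q : G) (I J X Y : {set G}).

Lemma block_disjoint I J : [disjoint I & J] -> [disjoint block H I & block H J].
Proof.
move/pred0P=> dIJ; apply/pred0P => u /=; rewrite !inE; exact: dIJ.
Qed.

Lemma uniform_ge i j X Y : adj i j -> [disjoint X & Y] -> i \notin X ->
    i \notin Y -> j \notin Y ->
    (forall k m, k \in X -> m \in Y -> ~~ connect (avoid i) k m) ->
  #|H i|%:R * gap_load H j + (#|block H X| * #|block H Y|)%:R
    <= #|H i|%:R * beta.
Proof.
move=> ij dXY iX iY jY sepXY.
have dis I k : k \notin I -> [disjoint block H I & block H [set k]].
  by move=> kI; apply: block_disjoint; rewrite disjoint_sym disjoints1.
have -> : #|H i|%:R * beta = \sum_(x in block H [set i]) betweenness x.
  by rewrite (eq_bigr (fun=> beta)) // sumr_const card_block1 mulr_natl.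
apply: betweenness_ge; rewrite ?dis ?block_disjoint //.
move=> u v s uX vY sP ls; apply: contraT => /hasPn noti.
rewrite !inE in uX vY; case/negP: (sepXY _ _ uX vY).
rewrite -ls; apply: path_avoid => //; apply/allP => x xs.
by have := noti x xs; rewrite !inE.
Qed.

Lemma leaf_uniform_le l p : (forall i, adj l i = (i == p)) ->
  beta <= gap_load H p + #|H l|%:R ^+ 2 / (2 * (#|H l| + #|H p|)%:R).
Proof.
move=> leaf_l; have := betweenness_leaf_sum_le H_gt0 connV leaf_l.
rewrite (eq_bigr (fun=> beta)) // sumr_const card_block1 -[leLHS]mulr_natl.
rewrite [_ ^+ 3]exprS -[X in _ + X]mulrA -mulrDr ler_pM2l //.
by rewrite ltr0n.
Qed.

Variables l p q : G.
Hypothesis leaf_l : forall i, adj l i = (i == p).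
Hypotheses (pq : adj p q) (ql : q != l).

Let a_gt0 : 0 < #|H l|%:R :> rat. Proof. by rewrite ltr0n. Qed.
Let b_gt0 : 0 < #|H p|%:R :> rat. Proof. by rewrite ltr0n. Qed.
Let c_gt0 : 0 < #|H q|%:R :> rat. Proof. by rewrite ltr0n. Qed.
Let lp : adj l p. Proof. by rewrite leaf_l. Qed.
Let lnp : l != p. Proof. exact: adj_neq. Qed.

(** [q] separates [l] and [p] from [Y]. Comparing the lower bound on block [q] with the upper bound
    on block [l] cancels [gap_load H p], which occurs in both. *)
Lemma end_first Y : q \notin Y ->
    (forall y, y \in Y -> ~~ connect (avoid q) p y) ->
  (2 * (#|H l| + #|H p|) ^ 2 * #|block H Y| <= #|H q| * #|H l| ^ 2)%N.
Proof.
move=> qY sepY; have pY : p \notin Y by apply/negP => /sepY; rewrite connect0.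
have pl : connect (avoid q) p l.
  by apply: connect1; rewrite /avoid /= adj_sym lp adj_neq // eq_sym ql.
have lY : l \notin Y by apply/negP => /sepY; rewrite pl.
have := @uniform_ge q p [set l; p] Y.
have dY : [disjoint [set l; p] & Y].
  by apply/pred0P => k; rewrite /= !inE; apply/negP => /andP[/orP[] /eqP->];
    apply/negP.
have sep k m : k \in [set l; p] -> m \in Y -> ~~ connect (avoid q) k m.
  move=> kX mY; apply: contra (sepY m mY); apply: connect_trans.
  by case/set2P: kX => ->.
have qX : q \notin [set l; p].
  by rewrite !inE negb_or ql eq_sym adj_neq.
rewrite adj_sym => /(_ pq dY qX qY pY sep); have := leaf_uniform_le leaf_l.
have -> : #|block H [set l; p]| = (#|H l| + #|H p|)%N.
  by rewrite card_block big_setU1 ?inE ?big_set1.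
rewrite -(ler_nat rat) !(natrD, natrM, natrX).
move: a_gt0 b_gt0 c_gt0.
move: #|H l|%:R #|H p|%:R #|H q|%:R #|block H Y|%:R (gap_load H p) => a b c z Q.
move=> a0 b0 c0 le1 le2.
have ab0 : 0 < a + b by rewrite addr_gt0.
have le3 : (a + b) * z <= c * (beta - Q) by rewrite mulrBr; lra.
have le4 : 2 * (a + b) * (beta - Q) <= a ^+ 2.
  have : beta - Q <= a ^+ 2 / (2 * (a + b)) by lra.
  by rewrite ler_pdivlMr ?mulr_gt0 // mulrC.
have -> : 2 * (a + b) ^+ 2 * z = 2 * (a + b) * ((a + b) * z) by ring.
apply: (@le_trans _ _ (2 * (a + b) * (c * (beta - Q)))).
  by rewrite ler_pM2l ?mulr_gt0.
by rewrite mulrCA ler_pM2l.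
Qed.

(** [p] separates [l] from [q], which gives the lower bound on block [p] once the nonnegative gap
    load of [l] is dropped. In the upper bound from the leaf, the gap load of [p] is estimated
    through its neighbouring blocks [l] and [q]. *)
Lemma end_second :
  #|H l|%:R * #|H q|%:R
    <= #|H p|%:R * (#|H p|%:R ^+ 2 / (2 * (#|H l| + #|H q|)%:R)
      + #|H l|%:R ^+ 2 / (2 * (#|H l| + #|H p|)%:R)) :> rat.
Proof.
have sep k m : k \in [set l] -> m \in [set q] -> ~~ connect (avoid p) k m.
  move=> /set1P-> /set1P->; apply/negP => /connectP[[|i s] /= sP eq_q].
    by case/eqP: (ql).
  by case/andP: sP => /and3P[li _ ip] _; rewrite leaf_l (negbTE ip) in li.
have := @uniform_ge p l [set l] [set q].
rewrite adj_sym !card_block1 !inE disjoints1 inE [l == q]eq_sym [p == l]eq_sym.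
rewrite (negbTE ql) (negbTE lnp) (negbTE (adj_neq pq)).
move=> /(_ lp isT isT isT isT sep); have := leaf_uniform_le leaf_l.
have := @gap_load_le _ H p [set l; q].
have -> : #|block H [set l; q]| = (#|H l| + #|H q|)%N.
  by rewrite card_block big_setU1 ?inE 1?eq_sym // big_set1.
rewrite addn_gt0 H_gt0 => /(_ _ isT) leQ le_beta le_ac.
have {}leQ : gap_load H p <= #|H p|%:R ^+ 2 / (2 * (#|H l| + #|H q|)%:R).
  by apply: leQ => i /set2P[] ->; rewrite // adj_sym.
have gap_ge0 : 0 <= gap_load H l.
  by apply: sumr_ge0 => e _; rewrite invr_ge0 ler0n.
rewrite -natrM; apply: le_trans (le_trans le_ac _).
  by rewrite lerDr mulr_ge0 ?ler0n.
by rewrite ler_pM2l //; lra.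
Qed.

End Uniform.

(** * The contradiction from the two ends of a longest path *)

Lemma long_path (G : sgraph) : connected_graph G -> (3 <= diameter G)%N ->
  exists L : seq G, [/\ sorted adj L, uniq L & (4 <= size L)%N].
Proof.
move=> connG diam.
have [u [v le3]] : exists u v : G, (3 <= dist u v)%N.
  have [|nope] := boolP [exists u : G, [exists v : G, (3 <= dist u v)%N]].
    by case/existsP=> u /existsP[v]; exists u, v.
  suff : (diameter G <= 2)%N by rewrite leqNgt diam.
  apply/bigmax_leqP => u _; apply/bigmax_leqP => v _.
  rewrite leqNgt; apply: contra nope => lt; apply/existsP; exists u.
  by apply/existsP; exists v.
have [p /and3P[pP _ pU]] := dist_geodesic (connG u v).
by exists (u :: p); rewrite /= size_tuple.
Qed.

Section Ends.

Variables (G : sgraph) (H : G -> sgraph).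
Hypothesis acycG : acyclic G.
Hypothesis H_gt0 : forall i, (0 < #|H i|)%N.
Hypothesis connV : connected_graph (blowup H).
Hypothesis uniV : betweenness_uniform (blowup H).

Lemma longest_end (l p q : G) s (Y : {set G}) :
    longest [:: l, p, q & s] -> {subset Y <= s} ->
  (2 * (#|H l| + #|H p|) ^ 2 * #|block H Y| <= #|H q| * #|H l| ^ 2)%N /\
  (2 * #|block H Y| < #|H l| + #|H p|)%N.
Proof.
move=> longL Ys; have leaf_l := longest_leaf acycG longL.
have [sL uL _] := longL.
have pq : adj p q by have /= /and3P[] := sL.
have ql : q != l.
  by apply: contraTneq uL => ->; rewrite /= !inE eqxx orbT.
have qY : q \notin Y.
  apply/negP => /Ys qs; move: uL.
  by rewrite !cons_uniq qs /= !andbF.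
have sepY y : y \in Y -> ~~ connect (avoid q) p y.
  by move/Ys; apply: tree_separates sL uL.
have betaP (x : blowup H) :
    betweenness x = betweenness (pick_block H_gt0 l : blowup H).
  exact: uniV.
have leI := end_first H_gt0 connV betaP leaf_l pq ql qY sepY.
split=> //; apply: end_arith leI _; rewrite ?H_gt0 //.
exact: (end_second H_gt0 connV betaP leaf_l pq ql).
Qed.

End Ends.

Local Close Scope ring_scope.

Theorem mainTheorem1 (G : sgraph) :
  is_tree G -> 3 <= diameter G ->
  ~ exists H : G -> sgraph,
      (forall i : G, 0 < #|H i|) /\ betweenness_uniform (blowup H).
Proof.
move=> [connG acycG] /(long_path connG)[L0 [sL0 uL0 le4]] [H [H_gt0 uniV]].
have [L longL /(leq_trans le4)] := longest_exists sL0 uL0.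
case: L longL => [|l [|p [|q [|r s]]]] // longL _.
have lp : adj l p by case: (longL) => /= /andP[].
have connV := blowup_connected H_gt0 connG lp.
have bound := longest_end acycG H_gt0 connV uniV.
have [_ uL _] := longL; have longR := longest_rev longL.
(* The empty case is a path of exactly four vertices, where each end is confronted with the opposite
   leaf alone. *)
case/lastP: s => [|s z] in longL longR uL *.
  have [|le1 _] := bound _ _ _ _ [set r] longL.
    by move=> k /set1P->; rewrite inE.
  have [|le2 _] := bound _ _ _ _ [set l] longR.
    by move=> k /set1P->; rewrite inE.
  rewrite !card_block1 in le1 le2.
  exact: two_end_arith le1 le2.
(* With five or more vertices, [y] and [z] are the last two, and they are disjoint from [l] and
   [p]. *)
have [t [y def_s]] : exists t y, r :: s = rcons t y.
  by exists (belast r s), (last r s); rewrite -lastI.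
have defL : [:: l, p, q, r & rcons s z] = [:: l, p, q & rcons (rcons t y) z].
  by rewrite -def_s.
rewrite defL in longL longR uL.
have card2 (i j : G) : i != j -> #|block H [set i; j]| = (#|H i| + #|H j|)%N.
  by move=> ij; rewrite card_block big_setU1 ?inE // big_set1.
have yz : y != z.
  move: uL => /= /and4P[_ _ _]; rewrite rcons_uniq mem_rcons inE eq_sym.
  by case/andP; rewrite negb_or => /andP[].
have lp' := adj_neq lp.
have [|_ lt1] := bound _ _ _ _ [set y; z] longL.
  by move=> k /set2P[] ->; rewrite !(mem_rcons, inE) eqxx ?orbT.
(* [q'] is the third vertex from the far end. It is [q] itself when there are five vertices, and [l]
   and [p] lie beyond it in every case. *)
have [q' [s' [defR ls ps]]] : exists q' s', [/\ rev [:: l, p, q & t] = q' :: s',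
    l \in s' & p \in s'].
  rewrite !rev_cons; case: (rev t) => [|q' t'] /=.
    by exists q, [:: p; l]; split; rewrite // !inE eqxx ?orbT.
  exists q', (rcons (rcons (rcons t' q) p) l).
  by split; rewrite // !(mem_rcons, inE) eqxx ?orbT.
have {}longR : longest [:: z, y, q' & s'].
  by move: longR; rewrite -defR -!rcons_cons !rev_rcons.
have [|_ lt2] := bound _ _ _ _ [set l; p] longR.
  by move=> k /set2P[] ->.
rewrite !card2 // in lt1 lt2.
(* Each of the sums [a + b] and [a' + b'] would exceed twice the other. *)
by move: #|H l| #|H p| #|H y| #|H z| lt1 lt2 => a b a' b'; lia.
Qed.
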